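(* Let $\mathbb{E}$ be a Euclidean space and let $\mathcal{X},\mathcal{Y}\subset\mathbb{E}$ be sets that are both $C^{(2)}$-manifolds around a point $z\in\mathcal{X}\cap\mathcal{Y}$. Suppose $z$ is an isolated point of $\mathcal{X}\cap\mathcal{Y}$ and that $\mathcal{X}$ and $\mathcal{Y}$ intersect transversally at $z$, i.e. $N_{\mathcal{X}}(z)\cap N_{\mathcal{Y}}(z)=\{0\}$. Then there exists an open neighborhood $W$ of $z$ such that, for every point $x\in\mathcal{X}\cap W$, the affine set $x+T_{\mathcal{X}}(x)$ intersects the set $\mathcal{Y}\cap W$ at a unique point $y(x)$, and moreover $$|y(x)-z| = O(|x-z|^2)\quad\text{as } x\to z \ (x\in\mathcal{X}).$$
   Context: A set $\mathcal{X}\subset\mathbb{E}$ is a $C^{(r)}$-manifold around $z\in\mathcal{X}$ if there is a $C^{(r)}$-smooth map $F\colon\mathbb{E}\to\mathbb{R}^m$ with surjective derivative $DF(z)$ such that $F^{-1}(0)$ is a neighborhood of $z$ in $\mathcal{X}$; equivalently there is an open neighborhood $U$ of $0$ in $\mathbb{R}^k$ and a $C^{(r)}$-smooth map $G\colon U\to\mathbb{E}$ with $G(0)=z$, everywhere injective derivative, and $G(U)$ a neighborhood of $z$ in $\mathcal{X}$. The tangent space is $T_{\mathcal{X}}(z)=\mathrm{Null}(DF(z))=\mathrm{Range}(DG(0))$ and the normal space is $N_{\mathcal{X}}(z)=\mathrm{Range}(DF(z)^* )=\mathrm{Null}(DG(0)^* )$, its orthogonal complement; the same definitions apply at points of $\mathcal{X}$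 near $z$. *)

(* Defs.v *)
From HB Require Import structures.
From mathcomp Require Import all_boot all_order all_algebra.
From mathcomp Require Import all_classical all_reals all_analysis.
Set Implicit Arguments. Unset Strict Implicit. Unset Printing Implicit Defensive.
Import Order.TTheory GRing.Theory Num.Theory.
Import numFieldNormedType.Exports.
Local Open Scope classical_set_scope.
Local Open Scope ring_scope.

Definition enorm (R : realType) (n : nat) (x : 'rV[R]_n) : R :=
  Num.sqrt (\sum_(i < n) x ord0 i ^+ 2).

(* C^1 : differentiable everywhere with continuous Jacobian
   (the derivative D f(x), represented in row convention: Df(x) v = v *m 'J f x) *)
Definition C1 (R : realType) (n m : nat) (f : 'rV[R]_n -> 'rV[R]_m) : Prop :=
  (forall x, differentiable f x) /\ continuous (fun x => jacobian f x).

Definition C2 (R : realType) (n m : nat) (f : 'rV[R]_n -> 'rV[R]_m) : Prop :=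
  C1 f /\ C1 (fun x => mxvec (jacobian f x)).

Definition chart2 (R : realType) (n m : nat) (X : set 'rV[R]_n) (x : 'rV[R]_n)
  (F : 'rV[R]_n -> 'rV[R]_m) : Prop :=
  [/\ X x, C2 F,
      (forall w : 'rV[R]_m, exists v : 'rV[R]_n, v *m jacobian F x = w) &
      exists V : set 'rV[R]_n, [/\ open V, V x &
         X `&` V = (fun y => F y = 0) `&` V]].

Definition manifold2_around (R : realType) (n : nat) (X : set 'rV[R]_n)
  (x : 'rV[R]_n) : Prop :=
  exists m (F : 'rV[R]_n -> 'rV[R]_m), chart2 X x F.

Definition mfd_tangent_space (R : realType) (n : nat) (X : set 'rV[R]_n)
  (x : 'rV[R]_n) : set 'rV[R]_n :=
  fun v => exists m (F : 'rV[R]_n -> 'rV[R]_m),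
    chart2 X x F /\ v *m jacobian F x = 0.

(* normal space N_X(x) = Range(DF(x)^* ); the adjoint of v |-> v *m J
   for the standard inner product is u |-> u *m J^T *)
Definition mfd_normal_space (R : realType) (n : nat) (X : set 'rV[R]_n)
  (x : 'rV[R]_n) : set 'rV[R]_n :=
  fun w => exists m (F : 'rV[R]_n -> 'rV[R]_m),
    chart2 X x F /\ exists u : 'rV[R]_m, w = u *m (jacobian F x)^T.

Arguments enorm {R n} x.
Arguments C1 {R n m} f.
Arguments C2 {R n m} f.
Arguments chart2 {R n m} X x F.
Arguments manifold2_around {R n} X x.
Arguments mfd_tangent_space {R n} X x _.
Arguments mfd_normal_space {R n} X x _.

(* Main.v *)
(* Near z write X = {F = 0} and Y = {G = 0}.  Transversality makes the joint
   derivative A = (DF(z), DG(z)) onto; if it had a kernel, Lyusternik's theorem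
   would produce points of X `&` Y other than z arbitrarily close to z, so A is
   invertible.  A point y lies in Y and in x + T_X(x) iff
   H_x(y) = (DF(x)(y - x), G(y)) vanishes, and for x near z the map H_x is a
   small Lipschitz perturbation of A.  Hence H_x has exactly one zero near z,
   at distance O(|H_x(z)|) from z, and H_x(z) = (DF(x)(z - x), 0) is O(|x - z|^2)
   by Taylor's formula since F(x) = F(z) = 0.  Estimates are made in the
   sup norm of 'rV[R]_n. *)
Require Import Defs.
From HB Require Import structures.
From mathcomp Require Import all_boot all_order all_algebra.
From mathcomp Require Import all_classical all_reals all_analysis.
From mathcomp Require Import ring lra.
Set Implicit Arguments. Unset Strict Implicit. Unset Printing Implicit Defensive.
Import Order.TTheory GRing.Theory Num.Theory.
Import numFieldNormedType.Exports.
Local Open Scope classical_set_scope.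
Local Open Scope ring_scope.

(* The library does not declare this join, which [banach_fixed_point] needs. *)
HB.instance Definition _ (R : realType) n m := Complete.on 'M[R]_(n, m).

(** * Sup-norm estimates for matrices and comparison with the Euclidean norm *)

Section MatrixNorm.
Context {R : realType}.

Lemma norm_mx_entry m n (A : 'M[R]_(m, n)) i j : `|A i j| <= `|A|.
Proof.
by rewrite [leRHS]/Num.Def.normr/= mx_normrE; exact: (le_bigmax _ _ (i, j)).
Qed.

Lemma norm_mx_le m n (A : 'M[R]_(m, n)) c :
  0 <= c -> (forall i j, `|A i j| <= c) -> `|A| <= c.
Proof.
move=> c0 Ac; rewrite [leLHS]/Num.Def.normr/= mx_normrE.
by apply: bigmax_le => // -[i j] _; exact: Ac.
Qed.

(** The entrywise sup norm is not submultiplicative: an entry of the product is a sum of [m] terms,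
    hence the factor [m]. *)
Lemma norm_mulmx_le m n (v : 'rV[R]_m) (A : 'M[R]_(m, n)) :
  `|v *m A| <= m%:R * `|A| * `|v|.
Proof.
apply: norm_mx_le => [|i j]; first by rewrite !mulr_ge0.
rewrite mxE (le_trans (ler_norm_sum _ _ _))//.
rewrite (@le_trans _ _ (\sum_(k < m) `|A| * `|v|))//; last first.
  by rewrite sumr_const card_ord -mulrA mulr_natl.
apply: ler_sum => k _; rewrite normrM mulrC.
by apply: ler_pM => //; exact: norm_mx_entry.
Qed.

(** [C2] speaks of the flattened Jacobian; this brings estimates for it back to the matrix
    itself. *)
Lemma norm_mxvec_ge m n (A : 'M[R]_(m, n)) : `|A| <= `|mxvec A|.
Proof. by apply: norm_mx_le => // i j; rewrite -mxvecE norm_mx_entry. Qed.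

Lemma norm_row_mx_le m n p (A : 'M[R]_(m, n)) (B : 'M[R]_(m, p)) c :
  `|A| <= c -> `|B| <= c -> `|row_mx A B| <= c.
Proof.
move=> Ac Bc; apply: norm_mx_le => [|i j]; first exact: le_trans Ac.
by rewrite mxE; case: fintype.split => k; apply: le_trans (norm_mx_entry _ _ _) _.
Qed.

Lemma norm_le_enorm n (x : 'rV[R]_n) : `|x| <= enorm x.
Proof.
apply: norm_mx_le => [|i j]; first exact: sqrtr_ge0.
rewrite (ord1 i) -sqrtr_sqr ler_sqrt ?sumr_ge0// => [|k _]; last exact: sqr_ge0.
by rewrite (bigD1 j)//= lerDl sumr_ge0// => k _; rewrite sqr_ge0.
Qed.

Lemma enorm_le_norm n (x : 'rV[R]_n) : enorm x <= Num.sqrt n%:R * `|x|.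
Proof.
rewrite -[`|x|]ger0_norm// -sqrtr_sqr -sqrtrM// ler_sqrt; last first.
  by rewrite mulr_ge0// sqr_ge0.
rewrite (@le_trans _ _ (\sum_(i < n) `|x| ^+ 2))//.
  apply: ler_sum => i _; rewrite -real_normK ?num_real//.
  by rewrite ler_pXn2r ?nnegrE// norm_mx_entry.
by rewrite sumr_const card_ord mulr_natl.
Qed.

Lemma norm_open n (V : set 'rV[R]_n) x : open V -> V x ->
  exists2 r : R, 0 < r & forall y, `|y - x| < r -> V y.
Proof.
move=> oV Vx; have /nbhs_ballP[r /= r0 rV] := open_nbhs_nbhs (conj oV Vx).
by exists r => // y yx; apply: rV; rewrite -ball_normE /ball_ /= distrC.
Qed.

Lemma closed_norm_le n (c : R) : closed [set u : 'rV[R]_n | `|u| <= c].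
Proof.
apply: (@closed_comp _ _ (@Num.norm R 'rV[R]_n) [set t | t <= c]) => [u _|].
  exact: norm_continuous.
exact: closed_le.
Qed.

End MatrixNorm.

(** * A mean value inequality relative to a fixed linear map *)

Section MeanValue.
Context {R : realType} {n m : nat} (f : 'rV[R]_n -> 'rV[R]_m).
Hypothesis df : forall x, differentiable f x.

(** Subtracting the linear term first makes the derivative along the line equal to the deviation of
    the Jacobian from [A]. *)
Lemma is_derive_along (x d : 'rV[R]_n) (A : 'M[R]_(n, m)) (j : 'I_m) (t : R) :
  is_derive t 1 (fun s : R => (f (x + s *: d) - s *: (d *m A)) 0 j)
    ((d *m ('J f (x + t *: d) - A)) 0 j).
Proof.
pose phi (s : R) := x + s *: d.
have dphi : is_diff t phi (fun s => s *: d).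
  by rewrite /phi; apply: is_diff_eq; rewrite add0r.
have ephi : differentiable phi t by case: dphi.
have dfphi : differentiable (f \o phi) t.
  by apply: differentiable_comp; [exact: ephi | exact: df].
have Dfphi : 'D_1 (f \o phi) t = d *m 'J f (phi t).
  rewrite deriveE// diff_comp//=.
  by rewrite diff_val scale1r -deriveE// deriveEjacobian.
have dj : is_derive t 1 (fun s => (f (phi s)) 0 j) ((d *m 'J f (phi t)) 0 j).
  have dv : derivable (f \o phi) t 1 by exact: diff_derivable.
  apply: DeriveDef; first by move/derivable_mxP : dv; exact.
  by move: (derive_mx dv); rewrite Dfphi => ->; rewrite mxE.
rewrite mulmxBr.
have -> : (fun s => (f (x + s *: d) - s *: (d *m A)) 0 j) =
   (fun s => f (phi s) 0 j) - (fun s => s * (d *m A) 0 j).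
  by apply/funext => s; rewrite !mxE.
have dl : is_derive t 1 (fun s : R => s * (d *m A) 0 j) ((d *m A) 0 j).
  by apply: is_derive_eq; rewrite scaler0 add0r [LHS]mulr1.
have := is_deriveB dj dl.
by rewrite !mxE.
Qed.

(** The scalar mean value theorem is applied to each coordinate, with its own intermediate point;
    the sup norm recombines the coordinates without loss. *)
Lemma mean_value (y y' : 'rV[R]_n) (A : 'M[R]_(n, m)) (c : R) :
  (forall t, 0 <= t <= 1 -> `|'J f (y' + t *: (y - y')) - A| <= c) ->
  `|f y - f y' - (y - y') *m A| <= n%:R * c * `|y - y'|.
Proof.
move=> Jc.
have c0 : 0 <= c by apply: le_trans (Jc 0 _); rewrite ?normr_ge0// lexx ler01.
apply: norm_mx_le => [|i j]; first by rewrite !mulr_ge0.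
rewrite (ord1 i).
have hd (t : R) := is_derive_along y' (y - y') A j t.
have [|s] := @MVT_segment R _ _ 0 1 ler01 (fun t _ => hd t).
  apply: continuous_subspaceT => t.
  by apply/differentiable_continuous/derivable1_diffP; apply: ex_derive.
rewrite in_itv/= => s01; rewrite subr0 mulr1 !scale1r !scale0r addr0 subrKC subr0.
have -> : (f y - f y' - (y - y') *m A) 0 j =
  (f y - (y - y') *m A) 0 j - f y' 0 j by rewrite !mxE; ring.
move=> ->; apply: le_trans (norm_mx_entry _ _ _) _.
apply: le_trans (norm_mulmx_le _ _) _.
by rewrite ler_wpM2r// ler_wpM2l// Jc.
Qed.

End MeanValue.

(** * Strict differentiability, and roots of Lipschitz perturbations of linear maps *)

Section StrictDifferentiability.
Context {R : realType}.

(** Both points vary, so near [x] the map [f] minus its linear part is Lipschitz with arbitrarily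
    small constant, as contraction arguments need. *)
Definition strict_diff n m (f : 'rV[R]_n -> 'rV[R]_m) x (A : 'M[R]_(n, m)) :=
  forall e : R, 0 < e -> exists2 r : R, 0 < r &
    forall y y', `|y - x| < r -> `|y' - x| < r ->
      `|f y - f y' - (y - y') *m A| <= e * `|y - y'|.

Lemma segment_ball n (x y y' : 'rV[R]_n) (r t : R) :
  0 <= t <= 1 -> `|y - x| < r -> `|y' - x| < r ->
  `|y' + t *: (y - y') - x| < r.
Proof.
move=> /andP[t0 t1] yr y'r.
have -> : y' + t *: (y - y') - x = t *: (y - x) + (1 - t) *: (y' - x).
  by apply/rowP => i; rewrite !mxE; ring.
apply: le_lt_trans (ler_normD _ _) _.
rewrite !normrZ (ger0_norm t0) ger0_norm ?subr_ge0//.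
(* For [t > 0] strictness comes from the term weighted by [t]; at [t = 0] that term vanishes and the
   other one must supply it. *)
have [->|tn0] := eqVneq t 0; first by rewrite mul0r add0r subr0 mul1r.
have t_gt0 : 0 < t by rewrite lt_def tn0.
have -> : r = t * r + (1 - t) * r by ring.
by rewrite ltr_leD// ?ltr_pM2l// ler_wpM2l ?subr_ge0// ltW.
Qed.

Lemma C1_strict_diff n m (f : 'rV[R]_n -> 'rV[R]_m) x :
  C1 f -> strict_diff f x ('J f x).
Proof.
move=> [df cJ] e e0.
(* This offsets the factor [n] of [mean_value]; [n.+1] keeps the tolerance positive when [n = 0]. *)
have d0 : 0 < e / n.+1%:R by rewrite divr_gt0.
have /cvgrPdist_lt/(_ _ d0)/nbhs_ballP[r /= r0 rJ] := cJ x.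
exists r => // y y' yr y'r.
have le_e : n%:R * (e / n.+1%:R) <= e.
  by rewrite mulrCA ler_piMr ?ltW// ltr_pdivrMr// mul1r ltr_nat.
apply: le_trans (ler_wpM2r (normr_ge0 _) le_e).
apply: mean_value => // t t01; rewrite distrC ltW//; apply: rJ.
by rewrite -ball_normE /ball_/= distrC segment_ball.
Qed.

Lemma strict_diff_lipschitz n m (f : 'rV[R]_n -> 'rV[R]_m) x A :
  strict_diff f x A -> exists L r : R, [/\ 0 <= L, 0 < r &
    forall y y', `|y - x| < r -> `|y' - x| < r ->
      `|f y - f y'| <= L * `|y - y'|].
Proof.
move=> /(_ 1 ltr01)[r r0 fr]; exists (1 + n%:R * `|A|), r; split => //.
move=> y y' yr y'r.
rewrite -[f y - f y'](subrK ((y - y') *m A)) mulrDl (le_trans (ler_normD _ _))//.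
by rewrite lerD ?fr// norm_mulmx_le.
Qed.

(** The expansion is based at the moving point [x] because tangent spaces are taken there. The
    Jacobian is Lipschitz near [z], so one constant serves all [x]. *)
Lemma C2_taylor n m (f : 'rV[R]_n -> 'rV[R]_m) z : C2 f ->
  exists C r : R, [/\ 0 <= C, 0 < r & forall x, `|x - z| < r ->
    `|f z - f x - (z - x) *m 'J f x| <= C * `|x - z| ^+ 2].
Proof.
move=> [[df _] C1J].
have [L [r [L0 r0 JL]]] := strict_diff_lipschitz (C1_strict_diff z C1J).
exists (n%:R * L), r; split => // [|x xr]; first by rewrite mulr_ge0.
rewrite expr2 mulrA -[in leRHS]distrC -(mulrA n%:R); apply: mean_value => // t t01.
apply: le_trans (norm_mxvec_ge _) _; rewrite raddfB/=.
have zr : `|z - z| < r by rewrite subrr normr0.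
apply: le_trans (JL _ _ (segment_ball t01 zr xr) xr) _.
rewrite ler_wpM2l// addrAC subrr add0r normrZ.
case/andP: t01 => t0 t1.
by rewrite ger0_norm// ler_piMl// -distrC.
Qed.

Lemma strict_diff_row_mx n m p (f : 'rV[R]_n -> 'rV[R]_m)
    (g : 'rV[R]_n -> 'rV[R]_p) x A B :
  strict_diff f x A -> strict_diff g x B ->
  strict_diff (fun y => row_mx (f y) (g y)) x (row_mx A B).
Proof.
move=> fA gB e e0; have [r r0 fr] := fA e e0; have [s s0 gs] := gB e e0.
exists (Num.min r s) => [|y y']; first by rewrite lt_min r0.
rewrite !lt_min => /andP[yr ys] /andP[y'r y's].
rewrite mul_mx_row !opp_row_mx !add_row_mx.
by apply: norm_row_mx_le; [exact: fr | exact: gs].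
Qed.

(** A right inverse suffices for existence, so this also applies to derivatives with a kernel. The
    bound 1/2 is the contraction factor and gives the factor 2 in the distance to the root. *)
Lemma exists_root n q (f : 'rV[R]_n -> 'rV[R]_q) (A : 'M[R]_(n, q))
    (B : 'M[R]_(q, n)) x (r e : R) :
  B *m A = 1%:M ->
  (forall y y', `|y - x| <= r -> `|y' - x| <= r ->
    `|f y - f y' - (y - y') *m A| <= e * `|y - y'|) ->
  0 <= e -> q%:R * `|B| * e <= 2^-1 -> 2 * (q%:R * `|B|) * `|f x| <= r ->
  exists2 y, f y = 0 & `|y - x| <= 2 * (q%:R * `|B|) * `|f x|.
Proof.
move=> BA fA e0 Be fxr; set k := q%:R * `|B| in Be fxr *.
have k0 : 0 <= k by rewrite mulr_ge0.
(* Looking for the root in the form x + u B turns the problem into a fixed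
   point of g, a contraction because B is a right inverse of A. *)
pose g u := u - f (x + u *m B).
(* Since [g 0] is [- f x] and [g] contracts by 1/2, this ball is mapped into itself. *)
pose U := [set u : 'rV[R]_q | `|u| <= 2 * `|f x|].
have UB u : U u -> `|u *m B| <= 2 * k * `|f x|.
  move=> Uu; apply: le_trans (norm_mulmx_le _ _) _; rewrite -/k.
  by rewrite [leRHS](_ : _ = k * (2 * `|f x|)) ?ler_wpM2l//; ring.
have subB u v : x + u *m B - (x + v *m B) = (u - v) *m B.
  by rewrite mulmxBl opprD addrACA subrr add0r.
have g_lip u v : U u -> U v -> `|g u - g v| <= 2^-1 * `|u - v|.
  move=> Uu Uv; rewrite -normrN.
  have -> : - (g u - g v) = f (x + u *m B) - f (x + v *m B) -
      (x + u *m B - (x + v *m B)) *m A.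
    rewrite subB -mulmxA BA mulmx1.
    by apply/rowP => i; rewrite !mxE; ring.
  apply: le_trans (fA _ _ _ _) _.
  - by rewrite (addrC x) addrK (le_trans (UB _ Uu)).
  - by rewrite (addrC x) addrK (le_trans (UB _ Uv)).
  rewrite subB.
  apply: (@le_trans _ _ (e * (k * `|u - v|))).
    by rewrite ler_wpM2l// norm_mulmx_le.
  by rewrite mulrA (mulrC e) ler_wpM2r.
have U0 : U 0 by rewrite /U/= normr0 mulr_ge0.
have g0 : g 0 = - f x by rewrite /g mul0mx addr0 add0r.
have gU u : U u -> U (g u).
  move=> Uu; have := g_lip _ _ Uu U0; rewrite g0 subr0 opprK => guf.
  rewrite /U/= -[g u](addrK (f x)) (le_trans (ler_normB _ _))//.
  by move: Uu guf; rewrite /U/=; lra.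
have @G : {fun U >-> U} by exists g; split; split.
have ctrG : is_contraction G.
  exists (2^-1)%:nng; split => [/=|[u v]/= [Uu Uv]]; last exact: g_lip.
  by rewrite invf_lt1// ltr1n.
have [u Uu gu] := banach_fixed_point ctrG (@closed_norm_le _ _ _)
  (ex_intro _ 0 U0).
exists (x + u *m B); last by rewrite addrAC subrr add0r UB.
by move/eqP: gu; rewrite -subr_eq0 opprB addrC subrK => /eqP.
Qed.

(** A left inverse bounds [y - y'] through its image under [A]. Replacing that image by [f y - f y']
    costs at most half the norm of [y - y'], which is absorbed on the left. *)
Lemma expansive n q (f : 'rV[R]_n -> 'rV[R]_q) (A : 'M[R]_(n, q))
    (B : 'M[R]_(q, n)) (e : R) y y' :
  A *m B = 1%:M -> `|f y - f y' - (y - y') *m A| <= e * `|y - y'| ->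
  q%:R * `|B| * e <= 2^-1 -> `|y - y'| <= 2 * (q%:R * `|B|) * `|f y - f y'|.
Proof.
move=> AB fA Be; set k := q%:R * `|B| in Be *.
have k0 : 0 <= k by rewrite mulr_ge0.
have : `|y - y'| <= k * (`|f y - f y'| + e * `|y - y'|).
  rewrite -{1}[y - y']mulmx1 -AB mulmxA (le_trans (norm_mulmx_le _ _))//.
  rewrite ler_wpM2l//; apply: le_trans (lerD (lexx _) fA).
  by rewrite -[X in `|X| <= _](subKr (f y - f y')) ler_normB.
have := ler_wpM2r (normr_ge0 (y - y')) Be.
by rewrite mulrDr mulrA; lra.
Qed.

End StrictDifferentiability.

(** * Tangent directions, independence of charts, and the joint derivative *)

Section Manifolds.
Context {R : realType}.

Lemma surjective_row_full m n (A : 'M[R]_(m, n)) :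
  (forall w : 'rV[R]_n, exists v : 'rV[R]_m, v *m A = w) -> row_full A.
Proof.
move=> Asurj; rewrite -sub1mx; apply/row_subP => i.
by have [v <-] := Asurj (row i 1%:M); exact: submxMl.
Qed.

(** At [x + t *: v] the value of [f] is [o(t)] because [v] is in the kernel, so [exists_root]
    started there finds a zero within [e * t]. *)
Lemma lyusternik n q (f : 'rV[R]_n -> 'rV[R]_q) (A : 'M[R]_(n, q)) x v :
  strict_diff f x A -> row_full A -> f x = 0 -> v *m A = 0 ->
  forall e r : R, 0 < e -> 0 < r -> exists t y,
    [/\ 0 < t, `|y - x| < r, f y = 0 & `|y - x - t *: v| <= e * t].
Proof.
move=> fA fullA fx vA e r e0 r0.
set B := pinvmx A; have BA : B *m A = 1%:M by exact: mulVpmx.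
pose k := q%:R * `|B|; have k0 : 0 <= k by rewrite mulr_ge0.
(* With this precision [2 * k * a] is at most 1, as the contraction requires, and [2 * k * a] times
   the norm of [v] is at most [e], which bounds the correction. *)
pose a := Num.min 1 (e / (`|v| + 1)) / (2 * (k + 1)).
have v1 : 0 < `|v| + 1 by rewrite ltr_wpDl.
have k1 : 0 < 2 * (k + 1) by rewrite mulr_gt0// ltr_wpDl.
have a0 : 0 < a by rewrite divr_gt0// lt_min ltr01 divr_gt0.
have ka : 2 * k * a <= Num.min 1 (e / (`|v| + 1)).
  rewrite /a mulrA ler_pdivrMr// mulrC ler_wpM2l//.
    by rewrite le_min ler01 divr_ge0// ltW.
  by rewrite ler_wpM2l// lerDl.
move: ka; rewrite le_min => /andP[ka1]; rewrite ler_pdivlMr// => kav.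
have {}kav : 2 * k * a * `|v| <= e.
  by apply: le_trans kav; rewrite ler_wpM2l ?lerDl// (mulr_ge0 _ (ltW a0))// mulr_ge0.
have [s s0 fs] := fA a a0.
pose d := Num.min r s.
have d0 : 0 < d by rewrite lt_min r0.
(* So small that the ball of radius [e * t] about [x + t *: v] stays within [d] of [x]. *)
pose t := d / (2 * (`|v| + e + 1)).
have ve1 : 0 < `|v| + e + 1 by rewrite ltr_wpDl// addr_ge0// ltW.
have t0 : 0 < t by rewrite divr_gt0// mulr_gt0.
have tve : t * (`|v| + e) < d.
  rewrite /t mulrAC ltr_pdivrMr ?mulr_gt0// ltr_pM2l//.
  by have := normr_ge0 v; lra.
have tv : `|t *: v| = t * `|v| by rewrite normrZ gtr0_norm.
have xx : `|x - x| < s by rewrite subrr normr0.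
have close y : `|y - (x + t *: v)| <= e * t -> `|y - x| < d.
  move=> yxt; have -> : y - x = y - (x + t *: v) + t *: v.
    by rewrite opprD addrA subrK.
  apply: le_lt_trans (ler_normD _ _) _; rewrite tv; apply: le_lt_trans tve.
  by rewrite mulrDr addrC lerD2l (mulrC t).
have ds : d <= s by rewrite ge_min lexx orbT.
have xt : `|x + t *: v - x| < s.
  by apply: lt_le_trans ds; apply: close; rewrite subrr normr0 mulr_ge0// ltW.
have fxt : 2 * k * `|f (x + t *: v)| <= e * t.
  have := fs _ _ xt xx.
  rewrite fx subr0 (addrC x) addrK -scalemxAl vA scaler0 subr0 tv => fxt.
  apply: (@le_trans _ _ (2 * k * (a * (t * `|v|)))).
    by rewrite ler_wpM2l// mulr_ge0.
  have -> : 2 * k * (a * (t * `|v|)) = 2 * k * a * `|v| * t by ring.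
  by rewrite ler_wpM2r// ltW.
have [||y fy yxt] := exists_root (e := a) BA _ (ltW a0) _ fxt.
- by move=> y y' /close yd /close y'd; apply: fs; apply: lt_le_trans ds.
- by rewrite -/k; lra.
exists t, y; split => //.
  apply: lt_le_trans (close _ _) _; first exact: le_trans yxt fxt.
  by rewrite ge_min lexx.
by rewrite -addrA -opprD; exact: le_trans yxt fxt.
Qed.

Lemma chart2_strict_diff n m (X : set 'rV[R]_n) x (F : 'rV[R]_n -> 'rV[R]_m) :
  chart2 X x F -> strict_diff F x ('J F x).
Proof. by case=> _ [C1F _] _ _; exact: C1_strict_diff. Qed.

Lemma chart2_row_full n m (X : set 'rV[R]_n) x (F : 'rV[R]_n -> 'rV[R]_m) :
  chart2 X x F -> row_full ('J F x).
Proof. by case=> _ _ /surjective_row_full. Qed.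

Lemma chart2_local n m (X : set 'rV[R]_n) x (F : 'rV[R]_n -> 'rV[R]_m) :
  chart2 X x F -> exists2 r : R, 0 < r &
    forall y, `|y - x| < r -> X y <-> F y = 0.
Proof.
case=> _ _ _ [V [oV Vx XV]]; have [r r0 rV] := norm_open oV Vx.
exists r => // y /rV Vy.
have : (X `&` V) y <-> ((fun y => F y = 0) `&` V) y by rewrite XV.
by case=> h1 h2; split => [Xy|Fy]; [case: (h1 (conj Xy Vy))|case: (h2 (conj Fy Vy))].
Qed.

Lemma chart2_val n m (X : set 'rV[R]_n) x (F : 'rV[R]_n -> 'rV[R]_m) :
  chart2 X x F -> F x = 0.
Proof.
move=> XF; have [r r0 rX] := chart2_local XF.
by apply/rX; [rewrite subrr normr0|case: XF].
Qed.

(** Tangent spaces do not depend on the chart: a kernel vector of ['J F x] is approximated by points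
    of [X], where [G] vanishes as well, so ['J G x] sends [t *: v] to [o(t)]. *)
Lemma chart2_kernel_sub n m p (X : set 'rV[R]_n) x
    (F : 'rV[R]_n -> 'rV[R]_m) (G : 'rV[R]_n -> 'rV[R]_p) (v : 'rV[R]_n) :
  chart2 X x F -> chart2 X x G -> v *m 'J F x = 0 -> v *m 'J G x = 0.
Proof.
move=> XF XG vF; apply/eqP; rewrite -normr_le0; apply/ler_addgt0Pl => e e0.
rewrite addr0.
have [rF rF0 XFr] := chart2_local XF; have [rG rG0 XGr] := chart2_local XG.
have c0 : 0 <= n%:R * `|'J G x| by rewrite mulr_ge0.
(* The final error is [t * a] times the sum of [a] and two fixed terms; [a <= 1] lets 1 replace the
   inner [a]. *)
pose a := Num.min 1 (e / (n%:R * `|'J G x| + `|v| + 1)).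
have cv1 : 0 < n%:R * `|'J G x| + `|v| + 1 by rewrite ltr_wpDl// addr_ge0.
have a0 : 0 < a by rewrite lt_min ltr01 divr_gt0.
have a1 : a <= 1 by rewrite ge_min lexx.
have ae : a * (n%:R * `|'J G x| + `|v| + 1) <= e.
  by rewrite -ler_pdivlMr// ge_min lexx orbT.
have [s s0 Gs] := chart2_strict_diff XG a0.
pose r := Num.min (Num.min rF rG) s.
have r0 : 0 < r by rewrite !lt_min rF0 rG0.
have [t [y [t0 yr Fy yxt]]] := lyusternik (chart2_strict_diff XF)
  (chart2_row_full XF) (chart2_val XF) vF a0 r0.
move: yr; rewrite !lt_min => /andP[/andP[yF yG] ys].
have Gy : G y = 0 by apply/XGr => //; apply/XFr.
have := Gs y x ys; rewrite subrr normr0 Gy (chart2_val XG) subr0 sub0r normrN.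
move=> /(_ s0) yJ.
have ytv : `|y - x| <= a * t + t * `|v|.
  rewrite -[y - x](subrK (t *: v)) (le_trans (ler_normD _ _))//.
  by rewrite normrZ (gtr0_norm t0) lerD2r.
rewrite -(ler_pM2l t0) -{1}(gtr0_norm t0) -normrZ scalemxAl.
have -> : t *: v *m 'J G x = (y - x) *m 'J G x - (y - x - t *: v) *m 'J G x.
  by rewrite -mulmxBl subKr.
apply: le_trans (ler_normB _ _) _.
have h1 : `|(y - x - t *: v) *m 'J G x| <= n%:R * `|'J G x| * (a * t).
  by apply: le_trans (norm_mulmx_le _ _) _; rewrite ler_wpM2l.
apply: le_trans (lerD yJ h1) _.
apply: (@le_trans _ _ (a * (a * t + t * `|v|) + n%:R * `|'J G x| * (a * t))).
  by rewrite lerD2r ler_wpM2l// ltW.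
apply: (@le_trans _ _ (t * (a * (n%:R * `|'J G x| + `|v| + 1)))); last first.
  by rewrite ler_pM2l.
rewrite -subr_ge0.
have -> : t * (a * (n%:R * `|'J G x| + `|v| + 1)) -
  (a * (a * t + t * `|v|) + n%:R * `|'J G x| * (a * t)) = t * a * (1 - a) by ring.
by rewrite !mulr_ge0 ?subr_ge0// ltW.
Qed.

Lemma tangent_spaceE n m (X : set 'rV[R]_n) (x v : 'rV[R]_n)
    (F : 'rV[R]_n -> 'rV[R]_m) :
  chart2 X x F -> mfd_tangent_space X x v <-> v *m 'J F x = 0.
Proof.
move=> XF; split => [[p [G [XG vG]]]|vF]; last by exists m, F.
exact: chart2_kernel_sub XG XF vG.
Qed.

(** By duality the transpose must be injective. A kernel element of it yields a vector common to
    both normal spaces, hence zero, and each block is injective by surjectivity of the chart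
    derivatives. *)
Lemma transversal_row_full n m p (X Y : set 'rV[R]_n) z
    (F : 'rV[R]_n -> 'rV[R]_m) (G : 'rV[R]_n -> 'rV[R]_p) :
  chart2 X z F -> chart2 Y z G ->
  mfd_normal_space X z `&` mfd_normal_space Y z = [set 0] ->
  row_full (row_mx ('J F z) ('J G z)).
Proof.
move=> XF YG N0; rewrite /row_full -mxrank_tr -/(row_free _); apply: inj_row_free => v.
rewrite tr_row_mx -[v]hsubmxK mul_row_col => uw0.
set u := lsubmx v in uw0 *; set w := rsubmx v in uw0 *.
have uN : (mfd_normal_space X z `&` mfd_normal_space Y z) (u *m ('J F z)^T).
  split; first by exists m, F; split => //; exists u.
  exists p, G; split => //; exists (- w); rewrite mulNmx.
  by apply/eqP; rewrite -addr_eq0 uw0.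
have u0 : u *m ('J F z)^T = 0 by move: uN; rewrite N0.
have w0 : w *m ('J G z)^T = 0 by move: uw0; rewrite u0 add0r.
have free q (H : 'rV[R]_n -> 'rV[R]_q) (c : 'rV[R]_q) : row_full ('J H z) ->
    c *m ('J H z)^T = 0 -> c = 0.
  rewrite /row_full -mxrank_tr -/(row_free _) => Hf c0.
  by apply: (row_free_inj Hf); rewrite c0 mul0mx.
rewrite (free _ _ _ (chart2_row_full XF) u0) (free _ _ _ (chart2_row_full YG) w0).
exact: row_mx0.
Qed.

Lemma isolated_row_free n m p (X Y : set 'rV[R]_n) z
    (F : 'rV[R]_n -> 'rV[R]_m) (G : 'rV[R]_n -> 'rV[R]_p) :
  chart2 X z F -> chart2 Y z G -> row_full (row_mx ('J F z) ('J G z)) ->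
  (exists U : set 'rV[R]_n, [/\ open U, U z & X `&` Y `&` U = [set z]]) ->
  row_free (row_mx ('J F z) ('J G z)).
Proof.
move=> XF YG full [U [oU Uz XYU]]; apply: inj_row_free => v vA.
apply/eqP; apply/negPn/negP => v0.
have [rX rX0 XFr] := chart2_local XF; have [rY rY0 YGr] := chart2_local YG.
have [rU rU0 UrU] := norm_open oU Uz.
have sd := strict_diff_row_mx (chart2_strict_diff XF) (chart2_strict_diff YG).
have fz : row_mx (F z) (G z) = 0.
  by rewrite (chart2_val XF) (chart2_val YG) row_mx0.
(* With half the norm of [v] as tolerance, the nearby zero [y] cannot be [z]. *)
have v2 : 0 < `|v| / 2 by rewrite divr_gt0// normr_gt0.
have r0 : 0 < Num.min (Num.min rX rY) rU by rewrite !lt_min rX0 rY0.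
have [t [y [t0 yr fy yzt]]] := lyusternik sd full fz vA v2 r0.
move: yr; rewrite !lt_min => /andP[/andP[yX yY] yU].
move/eqP: fy; rewrite row_mx_eq0 => /andP[/eqP Fy /eqP Gy].
have : (X `&` Y `&` U) y.
  by split; [split; [exact/XFr|exact/YGr]|exact: UrU].
rewrite XYU/= => yz; move: yzt.
rewrite yz subrr sub0r normrN normrZ gtr0_norm// mulrC ler_pM2r//.
by have := v0; rewrite -normr_gt0; lra.
Qed.

End Manifolds.

(** * Solving for the point [y(x)] and estimating its distance to [z] *)

Theorem theorem3p1 (R : realType) (n : nat) (X Y : set 'rV[R]_n) (z : 'rV[R]_n) :
  X z -> Y z ->
  manifold2_around X z -> manifold2_around Y z ->
  (exists U : set 'rV[R]_n, [/\ open U, U z & X `&` Y `&` U = [set z]]) ->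
  (mfd_normal_space X z `&` mfd_normal_space Y z) = [set 0] ->
  exists W : set 'rV[R]_n,
    [/\ open W, W z,
      (forall x, X x -> W x ->
         exists! y, [/\ Y y, W y & mfd_tangent_space X x (y - x)]) &
      exists (C delta : R), 0 < delta /\
        forall x y, X x -> W x -> enorm (x - z) < delta ->
          Y y -> W y -> mfd_tangent_space X x (y - x) ->
          enorm (y - z) <= C * enorm (x - z) ^+ 2].
Proof.
move=> _ _ [m [F XF]] [p [G YG]] isolated transversal.
have [_ C2F _ [V [oV Vz XV]]] := XF.
set A := row_mx ('J F z) ('J G z).
have fullA : row_full A := transversal_row_full XF YG transversal.
have freeA : row_free A := isolated_row_free XF YG fullA isolated.
pose B := pinvmx A.
have BA : B *m A = 1%:M by exact: mulVpmx.
have AB : A *m B = 1%:M by exact: mulmxVp.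
(* [k] bounds the operator norm of [B], and [e] is chosen so that [k * e] is at most 1/2, for both
   [exists_root] and [expansive]. *)
pose k := (m + p)%:R * `|B|.
have k0 : 0 <= k by rewrite mulr_ge0.
pose e := (2 * (k + 1))^-1.
have k1 : 0 < 2 * (k + 1) by rewrite mulr_gt0// ltr_wpDl.
have e0 : 0 < e by rewrite invr_gt0.
have ke : k * e <= 2^-1.
  by rewrite /e ler_pdivrMr// mulrA mulVf ?mul1r ?lerDl// pnatr_eq0.
have [r1 r10 JFr] : exists2 r : R, 0 < r &
    forall x (v : 'rV[R]_n), `|x - z| < r -> `|v *m ('J F x - 'J F z)| <= e * `|v|.
  have e1 : 0 < e / n.+1%:R by rewrite divr_gt0.
  have /cvgrPdist_lt/(_ _ e1)/nbhs_ballP[r /= r0 rJ] := C2F.1.2 z.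
  exists r => // x v xr; apply: le_trans (norm_mulmx_le _ _) _.
  rewrite ler_wpM2r// -normrN opprB.
  have /ltW Jx : `|'J F z - 'J F x| < e / n.+1%:R.
    by apply: rJ; rewrite -ball_normE /ball_/= distrC.
  apply: (@le_trans _ _ (n%:R * (e / n.+1%:R))); first by rewrite ler_wpM2l.
  by rewrite mulrCA ler_piMr ?(ltW e0)// ler_pdivrMr// mul1r ler_nat.
have [r2 r20 Gr] := chart2_strict_diff YG e0.
have [C [r3 [C0 r30 Fr]]] := C2_taylor z C2F.
have [rX rX0 XFr] := chart2_local XF.
have [rY rY0 YGr] := chart2_local YG.
have [rV rV0 VrV] := norm_open oV Vz.
(* Below this radius the quadratic bound [2 * k * C] times the square of the norm of [x - z] is at
   most half that norm. *)
pose r4 := (2 * (2 * k * C + 1))^-1.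
have kC0 : 0 <= 2 * k * C by rewrite !mulr_ge0.
have kC1 : 0 < 2 * (2 * k * C + 1) by rewrite mulr_gt0// ltr_wpDl.
have r40 : 0 < r4 by rewrite invr_gt0.
have kCr : 2 * k * C * r4 <= 2^-1.
  by rewrite /r4 ler_pdivrMr// (mulrA 2^-1) mulVf ?mul1r ?lerDl// pnatr_eq0.
pose r := Num.min (Num.min (Num.min r1 r2) (Num.min r3 r4))
  (Num.min (Num.min rX rY) rV).
have r0 : 0 < r by rewrite !lt_min r10 r20 r30 r40 rX0 rY0.
have rP y : `|y - z| < r -> [/\ `|y - z| < r1, `|y - z| < r2, `|y - z| < r3 &
    [/\ `|y - z| < rX, `|y - z| < rY & `|y - z| < rV]].
  by rewrite !lt_min => /andP[/andP[/andP[-> ->] /andP[-> _]] /andP[/andP[-> ->] ->]].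
pose H x y := row_mx ((y - x) *m 'J F x) (G y).
have HA x y y' : `|x - z| < r -> `|y - z| < r -> `|y' - z| < r ->
    `|H x y - H x y' - (y - y') *m A| <= e * `|y - y'|.
  move=> /rP[x1 _ _ _] /rP[_ y2 _ _] /rP[_ y'2 _ _].
  rewrite /H /A mul_mx_row !opp_row_mx !add_row_mx; apply: norm_row_mx_le.
    rewrite -mulmxBl opprB addrA subrK -mulmxBr; exact: JFr.
  exact: Gr.
(* Needed because [mfd_tangent_space X x] refers to charts at [x], not at [z]. *)
have XFx x : X x -> `|x - z| < r -> chart2 X x F.
  move=> Xx xr; have [_ _ _ [_ _ xV]] := rP _ xr; split => //; last first.
    by exists V; split => //; exact: VrV.
  (* DF(x) v = w is solved by the same perturbation argument as H_x(y) = 0. *)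
  move=> w; pose f v := row_mx (v *m 'J F x - w) (v *m 'J G z).
  have fA (v v' : 'rV[R]_n) : `|f v - f v' - (v - v') *m A| <= e * `|v - v'|.
    rewrite /f /A mul_mx_row !opp_row_mx !add_row_mx; apply: norm_row_mx_le.
      rewrite opprB addrA subrK -mulmxBl -mulmxBr; apply: JFr.
      by have [] := rP _ xr.
    by rewrite -mulmxBl subrr normr0 mulr_ge0// ltW.
  (* As [f] is affine, [fA] holds globally and the radius may be as large as the value of [f] at 0
     demands. *)
  have [v /eqP] := exists_root (x := 0) BA (fun v v' _ _ => fA v v')
    (ltW e0) ke (lexx _).
  by rewrite row_mx_eq0 subr_eq0 => /andP[/eqP vw _] _; exists v.
have HP x y : X x -> `|x - z| < r -> `|y - z| < r ->
    (Y y /\ mfd_tangent_space X x (y - x)) <-> H x y = 0.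
  move=> Xx xr yr; rewrite (tangent_spaceE _ (XFx x Xx xr)).
  have [_ _ _ [_ yY _]] := rP _ yr; rewrite (YGr y yY).
  split=> [[Gy Fy]|/eqP]; first by rewrite /H Gy Fy row_mx0.
  by rewrite row_mx_eq0 => /andP[/eqP-> /eqP->].
have Hz x : X x -> `|x - z| < r -> `|H x z| <= C * `|x - z| ^+ 2.
  move=> Xx xr; have [_ _ x3 [xX _ _]] := rP _ xr.
  have Fx : F x = 0 by exact/XFr.
  have := Fr x x3; rewrite Fx (chart2_val XF) subrr sub0r normrN => FC.
  apply: norm_row_mx_le => //.
  by rewrite (chart2_val YG) normr0 mulr_ge0// sqr_ge0.
have zr : `|z - z| < r by rewrite subrr normr0.
have W_E y : ball z r y <-> `|y - z| < r by rewrite -ball_normE /ball_/= distrC.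
exists (ball z r); split.
- exact: ball_open.
- exact/W_E.
- move=> x Xx /W_E xr.
  (* [exists_root] works on a closed ball, whereas [HA] holds on the open ball of radius [r]; hence
     the radius [r / 2]. *)
  have zx2 : 2 * k * `|H x z| <= r / 2.
    apply: (@le_trans _ _ (2 * k * (C * `|x - z| ^+ 2))).
      by rewrite ler_wpM2l ?Hz// mulr_ge0.
    have -> : 2 * k * (C * `|x - z| ^+ 2) = 2 * k * C * `|x - z| * `|x - z| by ring.
    rewrite (mulrC r); apply: ler_pM => //; [by rewrite mulr_ge0| |exact: ltW].
    apply: le_trans kCr; rewrite ler_wpM2l//.
    by move: xr; rewrite !lt_min => /andP[/andP[_ /andP[_ /ltW]]].
  have rr y : `|y - z| <= r / 2 -> `|y - z| < r by move=> yr; lra.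
  have [||y Hy yz] := exists_root (f := H x) (x := z) (r := r / 2)
    BA _ (ltW e0) ke.
  + by move=> y y' /rr yr /rr y'r; exact: HA.
  + exact: zx2.
  have yr : `|y - z| < r by apply: rr; exact: le_trans yz zx2.
  have [Yy Ty] := (HP x y Xx xr yr).2 Hy.
  exists y; split; first by split => //; exact/W_E.
  move=> y' [Yy' /W_E y'r Ty'].
  have Hy' : H x y' = 0 by apply/HP.
  have := expansive AB (HA x y y' xr yr y'r) ke.
  by rewrite Hy Hy' subrr normr0 mulr0 normr_le0 subr_eq0 => /eqP.
(* The factor [Num.sqrt n%:R] converts the sup norm of [y - z] to the Euclidean one. The estimate
   holds on the whole ball, so any positive [delta] works. *)
- exists (Num.sqrt n%:R * (2 * k * C)), 1; split => // x y Xx /W_E xr _ Yy /W_E yr Ty.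
  have Hy : H x y = 0 by apply/HP.
  have := expansive AB (HA x y z xr yr zr) ke.
  rewrite Hy sub0r normrN => yz.
  apply: le_trans (enorm_le_norm _) _; rewrite -[leRHS]mulrA ler_wpM2l ?sqrtr_ge0//.
  apply: (le_trans yz); rewrite -/k -[leRHS]mulrA ler_wpM2l ?mulr_ge0//.
  apply: le_trans (Hz x Xx xr) _; rewrite ler_wpM2l//.
  by rewrite ler_pXn2r ?nnegrE ?norm_le_enorm ?sqrtr_ge0.
Qed.
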